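(* Let $D$ be a strongly connected digraph of order $n\ge 4$ that is neither a strongly connected bicyclic digraph nor (isomorphic to) the directed cycle $C_n$. Then $\rho(D)>\rho(\theta(0,2,n-4))$.
   Context: Digraphs have no loops and no multiple arcs (arcs $uv$ and $vu$ may both be present). The spectral radius $\rho(D)$ of a digraph $D$ is the largest modulus of an eigenvalue of its adjacency matrix. A digraph is strongly connected if for every ordered pair of vertices there is a directed path from the first to the second; a strongly connected bicyclic digraph is a strongly connected digraph with $|E(D)|=|V(D)|+1$. $C_n$ is the directed cycle on $n$ vertices. Let $P_m$ denote a directed path on $m$ vertices. For integers $0\le a\le b$, $c\ge 0$, the $\theta$-digraph $\theta(a,b,c)$ consists of three internally vertex-disjoint directed paths $P_{a+2}$, $P_{b+2}$, $P_{c+2}$ such that $P_{a+2}$ and $P_{b+2}$ both start at the terminal vertex of $P_{c+2}$ and both end at the initial vertex of $P_{c+2}$; it has order $a+b+c+2$. *)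

(* Defs.v *)
From HB Require Import structures.
From mathcomp Require Import all_boot all_order all_algebra.
From mathcomp Require Import boolp classical_sets reals.
From mathcomp Require Import complex.
Set Implicit Arguments.
Unset Strict Implicit.
Unset Printing Implicit Defensive.
Import Order.TTheory GRing.Theory Num.Theory.

Local Open Scope ring_scope.

(* A digraph on the finite vertex type T is a relation
   e : rel T, where e u v means that uv is an arc.  Being a relation excludes
   multiple arcs; the absence of loops is the predicate [irreflexive e]. *)

Section Digraphs.
Variables (T : finType) (e : rel T).

Definition arcs : {set T * T} := [set p | e p.1 p.2].

Definition strongly_connected : Prop := forall u v : T, connect e u v.

Definition strongly_connected_bicyclic : Prop :=
  strongly_connected /\ #|arcs| = (#|T| + 1)%N.

Definition adjacency_matrix (K : pzSemiRingType) : 'M[K]_#|T| :=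
  \matrix_(i, j) (e (enum_val i) (enum_val j))%:R.

(* The set of moduli is finite, and nonempty as soon as T is, so that its
   supremum is its maximum; it is 0 when T is empty. *)
Definition spectral_radius (R : realType) : R :=
  sup [set ComplexField.Normc.normc z
      | z in [set z : R[i] | eigenvalue (adjacency_matrix R[i]) z]]%classic.

End Digraphs.

Arguments adjacency_matrix {T} e K.
Arguments spectral_radius {T} e R.

Definition isomorphic (T U : finType) (e : rel T) (f : rel U) : Prop :=
  exists2 h : T -> U, bijective h & forall u v, f (h u) (h v) = e u v.

(* For n = 1 this relation is a loop. *)
Definition directed_cycle (n : nat) : rel 'I_n :=
  fun i j => (j : nat) == (i.+1 %% n)%N.

Arguments directed_cycle n : clear implicits.

Definition path_arcs (s : seq nat) : seq (nat * nat) := zip s (behead s).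

(* Vertex 0 is the terminal vertex of P_(c+2) and vertex 1 its initial vertex;
   the a + b + c internal vertices of the three paths are numbered
   consecutively from 2.  For a = b = 0 the two parallel arcs from 0 to 1
   collapse into one. *)
Definition theta (a b c : nat) : rel 'I_(a + b + c + 2) :=
  let Pa := 0%N :: rcons (iota 2 a) 1%N in
  let Pb := 0%N :: rcons (iota (2 + a) b) 1%N in
  let Pc := 1%N :: rcons (iota (2 + a + b) c) 0%N in
  fun u v => (val u, val v) \in path_arcs Pa ++ path_arcs Pb ++ path_arcs Pc.

Arguments theta a b c : clear implicits.

(* Main.v *)
Require Import Defs.
From mathcomp Require Import all_boot all_order all_algebra.
From mathcomp Require Import boolp classical_sets reals topology normedtype derive.
From mathcomp Require Import complex ring lra zify.
Import Order.TTheory GRing.Theory Num.Theory.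
Import numFieldNormedType.Exports.
Local Open Scope ring_scope.
Set Implicit Arguments.
Unset Strict Implicit.
Unset Printing Implicit Defensive.

(* Let [lam] > 1 solve [lam ^ n = lam ^ 2 + 1].  The digraph theta(0,2,n-4) has
   a positive right eigenvector for [lam], hence its spectral radius is at most
   [lam].  By a compactness argument of Perron-Frobenius type, lam < rho(D) as
   soon as some nonnegative row vector v satisfies v A >= lam v with v A <> lam v.

   Take v(u) = lam ^ (n - 1 - dist(r, u)): a predecessor of u on a shortest path
   from r gives the inequality at every u <> r, and at r it says that the v(w),
   w -> r, sum to at least lam ^ 2 + 1.  This holds strictly if r has three
   in-neighbours, and it holds if r has two in-neighbours one of which is at
   distance at most n - 3 from r; strictness then comes from a second vertex of
   in-degree 2, which exists because D has at least n + 2 arcs.  Otherwise all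
   in-neighbours of such vertices are at distance at least n - 2, and the layers
   of the distance from r force D to contain the Hamiltonian cycle
   0 -> 1 -> ... -> n-1 -> 0 with the chords n-2 -> 0 and n-1 -> 1, for which an
   explicit v works. *)

(** * Subinvariant vectors and the Perron root of a nonnegative irreducible matrix *)

Section PerronRoot.
Variables (R : realType) (n : nat) (A : 'M[R]_n) (m : nat).
Hypothesis A_ge0 : forall i j, 0 <= A i j.
Hypothesis A_prim : forall i j, 0 < ((1 + A) ^+ m) i j.

Lemma mulmx_prim_gt0 (x : 'rV[R]_n) : (forall i, 0 <= x 0 i) -> x != 0 ->
  forall j, 0 < (x *m (1 + A) ^+ m) 0 j.
Proof.
move=> x_ge0 /rV0Pn[i xi_neq0] j; rewrite mxE (bigD1 i) //=.
apply: ltr_wpDr; last by rewrite mulr_gt0 // lt0r xi_neq0 x_ge0.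
by apply: sumr_ge0 => k _; rewrite mulr_ge0 // ltW.
Qed.

(* Right multiplication by [(1 + A) ^+ m] commutes with [A] and turns the nonzero
   defect [x *m A - t *: x] into an entrywise positive one. *)
Lemma subinvariant_improve (x : 'rV[R]_n) (t : R) :
    (forall i, 0 <= x 0 i) -> (forall i, t * x 0 i <= (x *m A) 0 i) ->
    x *m A != t *: x ->
  exists (s : R) (y : 'rV[R]_n),
    [/\ t < s, forall i, 0 <= y 0 i, \sum_i y 0 i = 1
      & forall i, s * y 0 i <= (y *m A) 0 i].
Proof.
move=> x_ge0 x_sub x_neq; set P := (1 + A) ^+ m.
have x_neq0 : x != 0 by apply: contraNneq x_neq => ->; rewrite mul0mx scaler0.
set z := x *m P; set d := (x *m A - t *: x) *m P.
have z_gt0 i : 0 < z 0 i by apply: mulmx_prim_gt0.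
have d_gt0 i : 0 < d 0 i.
  apply: mulmx_prim_gt0; last by rewrite subr_eq0.
  by move=> j; rewrite [leRHS]mxE [X in _ + X]mxE [X in _ - X]mxE subr_ge0.
have zA : z *m A = d + t *: z.
  rewrite /d /z mulmxBl -scalemxAl subrK -!mulmxA; congr (_ *m _).
  have /commrX : GRing.comm A (1 + A) by apply: commrD; [exact: commr1|].
  by move=> /(_ m).
(* [e] is the largest constant up to 1 with [e *: z <= d] entrywise; as [z *m A = d + t *: z], the
   vector [z] is subinvariant for [t + e]. *)
clearbody z d; set e := \big[Order.min/1]_i (d 0 i / z 0 i).
have e_gt0 : 0 < e.
  by apply: lt_bigmin => // i _; rewrite divr_gt0.
have s_gt0 : 0 < \sum_i z 0 i.
  have /rV0Pn[i _] := x_neq0; rewrite (bigD1 i) //=; apply: ltr_wpDr => //.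
  by apply: sumr_ge0 => k _; apply: ltW.
exists (t + e), ((\sum_i z 0 i)^-1 *: z); split.
- by rewrite ltrDl.
- by move=> i; rewrite mxE mulr_ge0 ?invr_ge0 ?ltW.
- under eq_bigr do rewrite mxE.
  by rewrite -mulr_sumr mulVf // gt_eqF.
- move=> i; rewrite -scalemxAl 2!mxE mulrCA ler_pM2l ?invr_gt0 //.
  rewrite zA mxE [(t *: z) 0 i]mxE mulrDl [leRHS]addrC lerD2l -ler_pdivlMr //.
  by apply: bigmin_le_cond.
Qed.

(** Supplies the upper end of a compact range for [t]: sum the inequalities and bound each entry of
    [x] by the total 1. *)
Lemma subinvariant_le_sum (x : 'rV[R]_n) (t : R) :
    (forall i, 0 <= x 0 i) -> \sum_i x 0 i = 1 ->
    (forall i, t * x 0 i <= (x *m A) 0 i) ->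
  t <= \sum_i \sum_j A j i.
Proof.
move=> x_ge0 x_sum x_sub; rewrite -[t]mulr1 -x_sum mulr_sumr.
apply: ler_sum => i _; apply: (le_trans (x_sub i)); rewrite mxE.
apply: ler_sum => j _; rewrite ler_piMl // -x_sum (bigD1 j) //= lerDl.
by apply: sumr_ge0.
Qed.

Local Open Scope classical_set_scope.

(** The extreme value theorem for the second projection on the compact set of feasible pairs
    [(x, t)] with [x] in the simplex and [t >= t0]. *)
Lemma subinvariant_max (x0 : 'rV[R]_n) (t0 : R) :
    (forall i, 0 <= x0 0 i) -> \sum_i x0 0 i = 1 ->
    (forall i, t0 * x0 0 i <= (x0 *m A) 0 i) ->
  exists (t : R) (x : 'rV[R]_n),
    [/\ t0 <= t, forall i, 0 <= x 0 i, \sum_i x 0 i = 1,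
        forall i, t * x 0 i <= (x *m A) 0 i
      & forall s (y : 'rV[R]_n), (forall i, 0 <= y 0 i) -> \sum_i y 0 i = 1 ->
          (forall i, s * y 0 i <= (y *m A) 0 i) -> s <= t].
Proof.
move=> x0_ge0 x0_sum x0_sub; set b := \sum_i \sum_j A j i.
pose box := [set x : 'rV[R]_n | forall i, `[0, 1] (x ord0 i)] `*` `[t0, b].
have box_compact : compact box.
  apply: compact_setX; last exact: segment_compact.
  apply: (@rV_compact _ n (fun=> `[(0 : R), 1])). by move=> _; apply: segment_compact.
pose S1 := [set p : 'rV[R]_n * R | \sum_i p.1 0 i = 1].
pose S2 := \bigcap_(i in [set: 'I_n])
  [set p : 'rV[R]_n * R | 0 <= (p.1 *m A) 0 i - p.2 * p.1 0 i].
have coordC i : continuous (fun p : 'rV[R]_n * R => p.1 0 i).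
  move=> p; apply: (@continuous_comp _ _ _ fst (fun x : 'rV[R]_n => x 0 i)).
    exact: cvg_fst.
  exact: coord_continuous.
have S1_closed : closed S1.
  apply: (@closed_comp _ _ (fun p : 'rV[R]_n * R => \sum_i p.1 0 i) [set 1]).
    by move=> p _; apply: cvg_big => [|i _]; [exact: add_continuous|exact: coordC].
  exact: closed_eq.
have S2_closed : closed S2.
  apply: closed_bigI => i _.
  apply: (@closed_comp _ _
    (fun p : 'rV[R]_n * R => (p.1 *m A) 0 i - p.2 * p.1 0 i) [set u | 0 <= u]).
    move=> p _; apply: cvgB; last first.
      by apply: cvgM; [exact: cvg_snd|exact: coordC].
    under eq_fun do rewrite mxE.
    rewrite mxE.
    apply: cvg_big => [|k _]; first exact: add_continuous.
    by apply: cvgMl; apply: coordC.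
  exact: closed_ge.
have S_compact : compact (box `&` (S1 `&` S2)).
  by apply: compact_closedI => //; apply: closedI.
have feasible s (y : 'rV[R]_n) : t0 <= s ->
    (forall i, 0 <= y 0 i) -> \sum_i y 0 i = 1 ->
    (forall i, s * y 0 i <= (y *m A) 0 i) ->
    (box `&` (S1 `&` S2)) (y, s).
  move=> s_ge y_ge0 y_sum y_sub; split; last first.
    by split=> // i _ /=; rewrite subr_ge0.
  split=> /= [i|]; rewrite in_itv /=; last first.
    by rewrite s_ge (@subinvariant_le_sum y).
  rewrite y_ge0 /= -y_sum (bigD1 i) //= lerDl.
  by apply: sumr_ge0.
have [||[x t]] := @compact_EVT_max _ _ snd _ _ S_compact.
- by exists (x0, t0); apply: feasible.
- by apply: continuous_subspaceT => p; apply: cvg_snd.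
rewrite inE => -[[/= x_box]]; rewrite in_itv /= => /andP[t_ge t_le].
move=> [x_sum x_sub] t_max; exists t, x; split=> //.
- by move=> i; have := x_box i; rewrite in_itv /= => /andP[].
- by move=> i; have := x_sub i Logic.I; rewrite /= subr_ge0.
- move=> s y y_ge0 y_sum y_sub; have [/ltW s_lt|s_ge] := ltP s t0.
    exact: le_trans t_ge.
  by have := t_max (y, s); apply; rewrite inE; apply: feasible.
Qed.

(** At the maximal value the inequality is an equality, since [subinvariant_improve] would otherwise
    exceed it. A first improvement, of [x] itself, makes the bound strict. *)
Lemma subinvariant_lt_eigenvalue (x : 'rV[R]_n) (t : R) :
    (forall i, 0 <= x 0 i) -> (forall i, t * x 0 i <= (x *m A) 0 i) ->
    x *m A != t *: x ->
  exists2 r, t < r & eigenvalue A r.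
Proof.
move=> x_ge0 x_sub x_neq.
have [s [y [ts y_ge0 y_sum y_sub]]] := subinvariant_improve x_ge0 x_sub x_neq.
have [r [z [sr z_ge0 z_sum z_sub r_max]]] := subinvariant_max y_ge0 y_sum y_sub.
exists r; first exact: lt_le_trans sr.
apply/eigenvalueP; exists z; last first.
  apply/eqP => z0; move: z_sum; rewrite big1 => [|i _]; last by rewrite z0 mxE.
  by move/esym/eqP; rewrite oner_eq0.
apply/eqP; apply: contraT => z_neq.
have [q [w [rq w_ge0 w_sum w_sub]]] := subinvariant_improve z_ge0 z_sub z_neq.
by have := r_max q w w_ge0 w_sum w_sub; rewrite leNgt rq.
Qed.
End PerronRoot.

(** * Bounds for the spectral radius of a digraph by test vectors *)

Section SpectralRadius.
Variables (R : realType) (T : finType) (D : rel T).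

Lemma adjacency_mulmx (v : T -> R) u :
  ((\row_i v (enum_val i)) *m adjacency_matrix D R) 0 (enum_rank u)
  = \sum_(w | D w u) v w.
Proof.
rewrite mxE (reindex_onto enum_rank enum_val) /=; last by move=> i _; rewrite enum_valK.
rewrite [RHS]big_mkcond /=; apply: eq_big => w; first by rewrite enum_rankK eqxx.
by rewrite !mxE !enum_rankK mulr_natr; case: (D w u).
Qed.

(** Pair the moduli of a left eigenvector with the weights [w]: the triangle inequality bounds the
    modulus of [z] times [S] by [mu] times [S], and [S] is positive. *)
Lemma eigenvalue_normc_le (w : T -> R) (mu : R) (z : R[i]) :
    (forall u, 0 < w u) -> (forall u, \sum_(v | D u v) w v <= mu * w u) ->
    eigenvalue (adjacency_matrix D R[i]) z ->
  ComplexField.Normc.normc z <= mu.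
Proof.
move=> w_gt0 w_sup /eigenvalueP[x xA x_neq0].
pose S := \sum_i `|x 0 i| * (w (enum_val i))%:C%C.
have S_gt0 : 0 < S.
  have /rV0Pn[i xi_neq0] := x_neq0; rewrite /S (bigD1 i) //=.
  apply: ltr_wpDr; first by apply: sumr_ge0 => k _; rewrite mulr_ge0 // lecR ltW.
  by rewrite mulr_gt0 ?normr_gt0 // ltcR.
suff : `|z| * S <= mu%:C%C * S by rewrite ler_pM2r // => H; rewrite -lecR.
rewrite /S !mulr_sumr.
have -> : \sum_(i < #|T|) `|z| * (`|x 0 i| * (w (enum_val i))%:C%C) =
    \sum_(i < #|T|) `|\sum_(j < #|T|) x 0 j * (D (enum_val j) (enum_val i))%:R|
      * (w (enum_val i))%:C%C.
  apply: eq_bigr => i _; rewrite mulrA -normrM.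
  have /rowP/(_ i) := xA; rewrite [in X in _ = X -> _]mxE => <-.
  by rewrite mxE; congr (`|_| * _); apply: eq_bigr => j _; rewrite mxE.
apply: (@le_trans _ _ (\sum_(i < #|T|) \sum_(j < #|T|) `|x 0 j|
    * ((D (enum_val j) (enum_val i))%:R * (w (enum_val i))%:C%C))).
  apply: ler_sum => i _; under [leRHS]eq_bigr do rewrite mulrA.
  rewrite -mulr_suml ler_wpM2r //; first by rewrite lecR ltW.
  apply: (le_trans (ler_norm_sum _ _ _)); apply: ler_sum => j _.
  by rewrite normrM normr_nat.
rewrite exchange_big /=; apply: ler_sum => j _.
rewrite -mulr_sumr mulrCA ler_wpM2l // -rmorphM /=.
have -> : \sum_(i < #|T|) (D (enum_val j) (enum_val i))%:R * (w (enum_val i))%:C%C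
    = (\sum_(v | D (enum_val j) v) w v)%:C%C :> R[i].
  rewrite rmorph_sum /= [RHS]big_mkcond /= (reindex_onto enum_rank enum_val) /=; last first.
    by move=> i _; rewrite enum_valK.
  apply: eq_big => v; first by rewrite enum_rankK eqxx.
  by rewrite enum_rankK mulr_natl; case: (D _ v).
by rewrite lecR.
Qed.

Lemma spectral_radius_le (w : T -> R) (mu : R) :
    0 <= mu -> (forall u, 0 < w u) ->
    (forall u, \sum_(v | D u v) w v <= mu * w u) ->
  spectral_radius D R <= mu.
Proof.
move=> mu_ge0 w_gt0 w_sup; rewrite /spectral_radius; set S := (X in sup X).
(* The supremum of the empty set is 0, hence the hypothesis [0 <= mu]. *)
have [->|S_neq0] := eqVneq S set0; first by rewrite sup0.
apply: ge_sup; first exact/set0P.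
by move=> _ [z z_eig <-]; apply: eigenvalue_normc_le w_gt0 w_sup z_eig.
Qed.

Lemma eigenvalue_le_spectral_radius (t : R) :
  0 <= t -> eigenvalue (adjacency_matrix D R) t -> t <= spectral_radius D R.
Proof.
move=> t_ge0 /eigenvalueP[x xA x_neq0]; apply: ub_le_sup.
  exists #|T|%:R => _ [z z_eig <-].
  apply: (@eigenvalue_normc_le (fun=> 1)) z_eig => // u.
  by rewrite mulr1 sumr_const ler_nat max_card.
exists t%:C%C; last by rewrite /= expr0n /= addr0 sqrtr_sqr ger0_norm.
apply/eigenvalueP; exists (map_mx (real_complex R) x); last by rewrite map_mx_eq0.
have <- : map_mx (real_complex R) (adjacency_matrix D R) = adjacency_matrix D R[i].
  by apply/matrixP => i j; rewrite !mxE rmorph_nat.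
by rewrite -map_mxM xA map_mxZ.
Qed.

(** The summand 1 lets a walk pause, so a walk of length at most [m] makes the entry of the [m]-th
    power positive; paths without repeated vertices are shorter than [#|T|]. *)
Lemma adjacency_primitive i j :
  strongly_connected D -> 0 < ((1 + adjacency_matrix D R) ^+ #|T|) i j.
Proof.
move=> D_sc; have B_ge0 k l : 0 <= (1 + adjacency_matrix D R) k l.
  by rewrite !mxE addr_ge0 ?ler0n.
have BX_ge0 m k l : 0 <= ((1 + adjacency_matrix D R) ^+ m) k l.
  elim: m k l => [|m IH] k l; first by rewrite expr0 mxE ler0n.
  by rewrite exprS mxE; apply: sumr_ge0 => ? _; rewrite mulr_ge0.
have walk_gt0 p u m : path D u p -> (size p <= m)%N ->
    0 < ((1 + adjacency_matrix D R) ^+ m) (enum_rank u) (enum_rank (last u p)).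
  elim: m p u => [|m IH] [|v p] u //=.
  - by rewrite expr0 mxE eqxx ltr01.
  - move=> _ _; rewrite exprS mxE (bigD1 (enum_rank u)) //=.
    apply: ltr_wpDr; first by apply: sumr_ge0 => ? _; rewrite mulr_ge0.
    apply: mulr_gt0; last exact: (IH [::]).
    by rewrite !mxE eqxx ltr_wpDr ?ler0n.
  - move=> /andP[uv vp] p_size; rewrite exprS mxE (bigD1 (enum_rank v)) //=.
    apply: ltr_wpDr; first by apply: sumr_ge0 => ? _; rewrite mulr_ge0.
    apply: mulr_gt0; last exact: IH.
    by rewrite !mxE !enum_rankK uv ltr_wpDl ?ler0n.
have /connectP[p ip jE] := D_sc (enum_val i) (enum_val j).
case/shortenP: ip jE => q iq q_uniq _ jE.
rewrite -(enum_valK i) -(enum_valK j) jE; apply: walk_gt0 => //.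
by have := max_card (mem (enum_val i :: q)); rewrite (card_uniqP q_uniq) => /ltnW.
Qed.

Lemma lt_spectral_radius (v : T -> R) (t : R) :
    strongly_connected D -> 0 <= t -> (forall u, 0 <= v u) ->
    (forall u, t * v u <= \sum_(w | D w u) v w) ->
    (exists u, t * v u < \sum_(w | D w u) v w) ->
  t < spectral_radius D R.
Proof.
move=> D_sc t_ge0 v_ge0 v_sub [u0 u0_lt].
have A_ge0 i j : 0 <= adjacency_matrix D R i j by rewrite mxE ler0n.
have [|||r tr r_eig] := @subinvariant_lt_eigenvalue _ _ _ _ A_ge0
  (fun i j => adjacency_primitive i j D_sc) (\row_i v (enum_val i)) t.
- by move=> i; rewrite mxE.
- by move=> i; rewrite mxE -{2}(enum_valK i) adjacency_mulmx.
- apply: contraTneq u0_lt => /rowP/(_ (enum_rank u0)).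
  by rewrite adjacency_mulmx !mxE enum_rankK => ->; rewrite ltxx.
- apply: (lt_le_trans tr); apply: eigenvalue_le_spectral_radius => //.
  exact: le_trans (ltW tr).
Qed.
End SpectralRadius.

(** * The number [lam] and the upper bound for the theta digraph *)

Section ThetaRadius.
Variable R : realType.

(** The equation says that [lam ^- (n - 2)] and [lam ^- n], the weights of the two cycles of
    theta(0,2,n-4), add up to 1. A root exists in [1, 2] by the intermediate value theorem. *)
Lemma theta_root n : (4 <= n)%N ->
  exists lam : R, [/\ 1 < lam, lam ^+ 2 < 2 & lam ^+ n = lam ^+ 2 + 1].
Proof.
move=> n_ge4; pose p : {poly R} := 'X^n - 'X^2 - 1.
have pE x : p.[x] = x ^+ n - x ^+ 2 - 1 by rewrite !hornerE.
have [||x /andP[x_ge1 _] /rootP] := @Num.Theory.poly_ivt R p 1 2.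
- by rewrite ler1n.
- rewrite !pE !expr1n subrr sub0r lerN10 /= -addrA -opprD subr_ge0.
  apply: (@le_trans _ _ (2 ^+ 4)); last by rewrite ler_eXn2l ?ltr1n.
  by rewrite -!natrX natr1 ler_nat.
rewrite pE => /eqP; rewrite -addrA -opprD subr_eq0 => /eqP xE; exists x.
have x_gt1 : 1 < x.
  rewrite lt_neqAle x_ge1 andbT; apply: contra_eq_neq xE => <-.
  by rewrite !expr1n -subr_eq0 opprD addrA subrr sub0r oppr_eq0 oner_eq0.
split=> //; rewrite ltNge; apply/negP => x2_ge2.
(* From [x ^+ 2 >= 2] follows [x ^+ 4 >= x ^+ 2 + 2], which exceeds [x ^+ n]. *)
have : x ^+ 4 <= x ^+ n by rewrite ler_eXn2l.
rewrite xE (exprM x 2 2); nra.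
Qed.

Lemma sum_le_at N (f : nat -> R) (P : pred 'I_N) k :
  (forall i, 0 <= f i) -> (forall i : 'I_N, P i -> val i = k) ->
  \sum_(i < N | P i) f i <= f k.
Proof.
move=> f_ge0 Pk; have [i Pi|P0] := pickP P; last by rewrite big_pred0.
rewrite (bigD1 i) //= (Pk i Pi) big1 ?addr0 // => j /andP[Pj /eqP[]].
by apply: val_inj; rewrite /= (Pk i Pi) (Pk j Pj).
Qed.

(** Reads off the successor of [a] on a path with consecutive internal vertices; [x < m] keeps the
    initial vertex apart from these. *)
Lemma mem_path_arcs_iota (x m c y a b : nat) : (x < m)%N ->
  (a, b) \in path_arcs (x :: rcons (iota m c) y) ->
  ((a == x) || (m <= a < m + c)%N) &&
  (b == if a == x then if c == 0%N then y else m
        else if a.+1 == (m + c)%N then y else a.+1).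
Proof.
rewrite /path_arcs /=; elim: c x m => [|c IH] x m xm /=.
  by rewrite !inE xpair_eqE => /andP[/eqP-> /eqP->]; rewrite !eqxx.
rewrite inE xpair_eqE => /orP[/andP[/eqP-> /eqP->]|]; first by rewrite !eqxx.
move=> /(IH m m.+1 (ltnSn m)) /andP[am /eqP->]; rewrite -addSnnS.
have /negPf-> : a != x by lia.
apply/andP; split; first by lia.
case: (eqVneq a m) => [->|//].
case: c {IH am} => [|c] /=; first by rewrite addn0 !eqxx.
by have /negPf-> : m.+1 != (m.+1 + c.+1)%N by lia.
Qed.

Lemma spectral_radius_theta_le n (lam : R) : (4 <= n)%N -> 1 < lam ->
  lam ^+ n = lam ^+ 2 + 1 -> spectral_radius (theta 0 2 (n - 4)) R <= lam.
Proof.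
move=> n_ge4 lam_gt1 lamE; set c := (n - 4)%N.
have lam_gt0 : 0 < lam by apply: lt_trans lam_gt1.
(* [lam ^+ e k] is the entry at vertex [k] of an eigenvector: [e] grows by one
   along every arc except those leaving the branching vertex [0]. *)
pose e (k : nat) := if k == 0%N then n else if k == 1%N then 3%N
  else if k == 2%N then 1%N else if k == 3%N then 2%N else k.
pose w k := lam ^+ e k.
have w_gt0 k : 0 < w k by apply: exprn_gt0.
have w_ge0 k : 0 <= w k by apply: ltW.
apply: (@spectral_radius_le _ _ _ (fun u => w (val u))) => // [|u].
  exact: ltW.
have arcE (v : 'I_(0 + 2 + c + 2)) : theta 0 2 c u v ->
    if val u == 0%N then (val v == 1%N) || (val v == 2%N)
    else e (val v) == (e (val u)).+1.
  rewrite /theta /= /path_arcs /= !inE !xpair_eqE.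
  case/or4P => [/andP[/eqP-> /eqP->]|/andP[/eqP-> /eqP->]|
    /andP[/eqP-> /eqP->]|/orP[/andP[/eqP-> /eqP->]|]] //.
  move: (val u) (val v) => a b ab.
  have /andP[a_range /eqP->] := @mem_path_arcs_iota 1 4 c 0 a b isT ab.
  rewrite /e; case: (eqVneq a 1%N) a_range => [-> _ /=|a1 /= a_range].
    by case: (eqVneq c 0%N) => [c0|c0] /=; lia.
  have /negPf-> : a != 0%N by lia.
  have /negPf-> : a != 2%N by lia.
  have /negPf-> : a != 3%N by lia.
  by case: (eqVneq a.+1 (4 + c)%N) => [ac|ac] /=; [lia|case: a a_range {a1 ab ac} => [|[|[|[|a]]]]].
have [u0|u_neq0] := eqVneq (val u) 0%N.
  (* This is [lam] times the equation [lamE]: the exponents at vertices 1 and 2 are 3 and 1. *)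
  have -> : lam * w (val u) = w 1%N + w 2%N.
    by rewrite u0 /w /e /= lamE expr1; ring.
  rewrite (bigID (fun v => val v == 1%N)) /=; apply: lerD.
    by apply: (@sum_le_at _ w) => // v /andP[_ /eqP].
  apply: (@sum_le_at _ w) => // v /andP[/arcE]; rewrite u0 /=.
  by move=> /orP[->|/eqP].
have [v0 uv0|P0] := pickP (theta 0 2 c u); last first.
  by rewrite big_pred0 // mulr_ge0 // ltW.
have := arcE v0 uv0; rewrite (negPf u_neq0) => /eqP v0E.
have -> : lam * w (val u) = w (val v0) by rewrite /w v0E exprS.
apply: (@sum_le_at _ w) => // v /arcE; rewrite (negPf u_neq0) => /eqP vE.
have v_lt : (val v < n)%N by have := ltn_ord v; rewrite /c /=; lia.
have v0_lt : (val v0 < n)%N by have := ltn_ord v0; rewrite /c /=; lia.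
(* [e] is injective below [n], so the two out-neighbours coincide. *)
have : e (val v) = e (val v0) by rewrite vE v0E.
move: {vE v0E uv0} (val v) (val v0) v_lt v0_lt => a b; rewrite /e.
by move: a b => [|[|[|[|a]]]] [|[|[|[|b]]]] /=; lia.
Qed.
End ThetaRadius.

(** * Walks and distances in a strongly connected digraph *)

Section Distance.
Variables (T : finType) (D : rel T).

Definition walk (u : T) (k : nat) (v : T) : bool :=
  [exists p : k.-tuple T, path D u p && (last u p == v)].

Lemma walkP u k v :
  reflect (exists p, [/\ path D u p, size p = k & last u p = v]) (walk u k v).
Proof.
apply: (iffP existsP) => [[p /andP[up /eqP pv]]|[p [up pk pv]]].
  by exists p; rewrite size_tuple.
by exists (Tuple (introT eqP pk)); rewrite /= up pv eqxx.
Qed.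

Lemma walk0 u : walk u 0 u.
Proof. by apply/walkP; exists [::]. Qed.

Lemma walk_rcons u k v w : walk u k v -> D v w -> walk u k.+1 w.
Proof.
move=> /walkP[p [up pk pv]] vw; apply/walkP; exists (rcons p w).
by rewrite rcons_path size_rcons last_rcons up pk pv.
Qed.

Lemma walkS_last u k w : walk u k.+1 w -> exists2 v, walk u k v & D v w.
Proof.
move=> /walkP[p]; case/lastP: p => [|p x] [//].
rewrite rcons_path size_rcons last_rcons => /andP[up px] [pk] xw.
by exists (last u p); rewrite -?xw //; apply/walkP; exists p.
Qed.

(* [dist r u = #|T|] when [u] is not reachable from [r]. *)
Definition dist (r u : T) : nat := find (fun k => walk r k u) (iota 0 #|T|).

Hypothesis D_sc : strongly_connected D.

Lemma has_walk r u : has (fun k => walk r k u) (iota 0 #|T|).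
Proof.
have /connectP[p rp uE] := D_sc r u; case/shortenP: rp uE => q rq q_uniq _ uE.
apply/hasP; exists (size q); last by apply/walkP; exists q.
by rewrite mem_iota; have := max_card (mem (r :: q)); rewrite (card_uniqP q_uniq).
Qed.

Lemma dist_lt r u : (dist r u < #|T|)%N.
Proof. by have := has_walk r u; rewrite has_find size_iota. Qed.

Lemma walk_dist r u : walk r (dist r u) u.
Proof.
have := nth_find 0%N (has_walk r u).
by rewrite -/(dist r u) nth_iota ?dist_lt.
Qed.

Lemma dist_le_walk r k u : walk r k u -> (dist r u <= k)%N.
Proof.
move=> rku; rewrite leqNgt; apply/negP => k_lt.
have := before_find 0%N k_lt; rewrite nth_iota ?add0n ?rku //.
exact: ltn_trans (dist_lt r u).
Qed.

Lemma dist_eq0 r u : (dist r u == 0%N) = (u == r).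
Proof.
apply/eqP/eqP => [d0|->]; last by apply/eqP; rewrite -leqn0 dist_le_walk ?walk0.
by have := walk_dist r u; rewrite d0 => /walkP[[|? ?] []].
Qed.

Lemma distxx r : dist r r = 0%N.
Proof. by apply/eqP; rewrite dist_eq0. Qed.

Lemma dist_arc r u v : D u v -> (dist r v <= (dist r u).+1)%N.
Proof. by move=> uv; apply: dist_le_walk; apply: walk_rcons uv; apply: walk_dist. Qed.

Lemma dist_pred r u : u != r -> exists2 w, D w u & dist r u = (dist r w).+1.
Proof.
rewrite -dist_eq0 -lt0n => d_gt0; have := walk_dist r u.
rewrite -(prednK d_gt0) => /walkS_last[w rw wu]; exists w => //.
by have := dist_le_walk rw; have := dist_arc r wu; lia.
Qed.

(** Iterating [dist_pred], a shortest walk to [u] meets every smaller distance. *)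
Lemma dist_back r u k : (k <= dist r u)%N ->
  exists2 w, dist r w = k & walk w (dist r u - k) u.
Proof.
move: {2}(dist r u - k)%N (erefl (dist r u - k)%N) => m.
elim: m u => [|m IH] u mE k_le.
  by exists u; [lia|rewrite mE; apply: walk0].
have /dist_pred[w wu dw] : u != r by rewrite -dist_eq0; lia.
have [x xk wx] : exists2 x, dist r x = k & walk x (dist r w - k) w by apply: IH; lia.
exists x => //.
have -> : (dist r u - k)%N = (dist r w - k).+1 by lia.
exact: walk_rcons wu.
Qed.

Lemma dist_back_dist r u k : (k <= dist r u)%N ->
  exists2 w, dist r w = k & (dist w u <= dist r u - k)%N.
Proof. by move=> /dist_back[w wk wu]; exists w => //; apply: dist_le_walk. Qed.
End Distance.

(** * Pigeonhole principle for vertex labellings *)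

Section Labelling.
Variables (T : finType) (L : T -> nat).

Lemma surjective_label_inj :
  (forall k, (k < #|T|)%N -> exists u, L u = k) -> injective L.
Proof.
move=> L_surj; apply/injectiveP; apply: (@leq_size_uniq _ (iota 0 #|T|)).
- exact: iota_uniq.
- move=> k; rewrite mem_iota add0n /= => /L_surj[u <-].
  by apply: map_f; rewrite mem_enum.
- by rewrite size_map size_iota -cardE.
Qed.

Lemma injective_label_surj : injective L -> (forall u, (L u < #|T|)%N) ->
  forall k, (k < #|T|)%N -> exists u, L u = k.
Proof.
move=> /injectiveP L_inj L_lt k k_lt.
have [||_ LE] := @uniq_min_size _ _ (iota 0 #|T|) L_inj.
- by move=> _ /mapP[u _ ->]; rewrite mem_iota L_lt.
- by rewrite size_map size_iota -cardE.
- have : k \in iota 0 #|T| by rewrite mem_iota.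
  by rewrite -LE => /mapP[u _ ->]; exists u.
Qed.
End Labelling.

(** * Arc counts and vertices of in-degree 2 *)

Section ArcCount.
Variables (T : finType) (D : rel T).
Hypothesis D_sc : strongly_connected D.

Lemma card_arcs_out : #|arcs D| = (\sum_u #|[pred v | D u v]|)%N.
Proof.
rewrite -sum1_card; under [RHS]eq_bigr do rewrite -sum1_card.
by rewrite pair_big_dep; apply: eq_bigl => -[u v]; rewrite !inE.
Qed.

Lemma card_arcs_in : #|arcs D| = (\sum_v #|[pred u | D u v]|)%N.
Proof.
rewrite card_arcs_out; under eq_bigr do rewrite -sum1_card.
under [RHS]eq_bigr do rewrite -sum1_card.
by rewrite (exchange_big_dep predT).
Qed.

Lemma out_gt0 u : (1 < #|T|)%N -> (0 < #|[pred v | D u v]|)%N.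
Proof.
move=> /card_gt1P[x [y [_ _ xy]]].
have [w wu] : exists w, w != u.
  by have [xu|] := eqVneq x u; [exists y; rewrite -xu eq_sym|exists x].
have /connectP[[|v p] /=] := D_sc u w; first by move=> _ wE; rewrite wE eqxx in wu.
by move=> /andP[uv _] _; apply/card_gt0P; exists v.
Qed.

(** Strong connectedness makes [f] surjective, hence a permutation with a single orbit; the position
    [findex f x0] on that orbit is the isomorphism. *)
Lemma functional_cycle (f : T -> T) :
  (forall u v, D u v = (f u == v)) -> (1 < #|T|)%N ->
  isomorphic D (directed_cycle #|T|).
Proof.
move=> Df T_gt1; have T_gt0 : (0 < #|T|)%N by apply: ltnW.
have /card_gt0P[x0 _] := T_gt0.
have f_conn u v : fconnect f u v.
  by rewrite -(@eq_connect _ D) //; apply: D_sc.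
have f_inj : injective f.
  have f_surj y : exists x, f x = y.
    have /card_gt1P[a [b [_ _ ab]]] := T_gt1.
    (* Starting from [w != y] forces at least one application of [f] to reach [y]. *)
    have [w wy] : exists w, w != y.
      by have [ay|] := eqVneq a y; [exists b; rewrite -ay eq_sym|exists a].
    have := iter_findex (f_conn w y); case: (findex f w y) => [/=|k] wkE.
      by rewrite wkE eqxx in wy.
    by exists (iter k f w).
  have rf_inj : injective (fun x => val (enum_rank (f x))).
    apply: surjective_label_inj => k k_lt.
    have [x fx] := f_surj (enum_val (Ordinal k_lt)).
    by exists x; rewrite fx enum_valK.
  by move=> x y fxy; apply: rf_inj; rewrite /= fxy.
have ordE : order f x0 = #|T| by apply: eq_card => u; rewrite !inE; apply: f_conn.
have h_lt u : (findex f x0 u < #|T|)%N by rewrite -ordE findex_max.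
have h_inj : injective (findex f x0).
  by move=> u v uv; rewrite -(iter_findex (f_conn x0 u)) uv iter_findex.
exists (fun u => Ordinal (h_lt u)).
  apply: inj_card_bij; last by rewrite card_ord.
  by move=> u v [/h_inj].
move=> u v; rewrite Df /directed_cycle /=.
suff -> : ((findex f x0 u).+1 %% #|T|)%N = findex f x0 (f u).
  by rewrite (inj_eq h_inj) eq_sym.
rewrite -{2}(iter_findex (f_conn x0 u)) -iterS.
have := h_lt u; rewrite leq_eqVlt => /orP[/eqP uE|u_lt].
  by rewrite uE modnn -ordE iter_order // findex0.
by rewrite modn_small // findex_iter // ordE.
Qed.

(** All out-degrees are positive, so there are at least [n] arcs. With exactly [n], all out-degrees
    are 1 and [D] is a cycle; [n + 1] is the bicyclic case. *)
Lemma card_arcs_ge n : #|T| = n -> (4 <= n)%N ->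
  ~ strongly_connected_bicyclic D -> ~ isomorphic D (directed_cycle n) ->
  (n + 2 <= #|arcs D|)%N.
Proof.
move=> Tn n_ge4 not_bicyclic not_cycle.
have T_gt1 : (1 < #|T|)%N by lia.
have n_le : (n <= #|arcs D|)%N.
  rewrite card_arcs_out -Tn -[X in (X <= _)%N]sum1_card.
  by apply: leq_sum => u _; apply: out_gt0.
have n1_neq : #|arcs D| != (n + 1)%N.
  by apply/eqP => n1; apply: not_bicyclic; split; rewrite ?Tn.
suff n_neq : #|arcs D| != n by lia.
apply/eqP => nE; apply: not_cycle.
have out1 u : #|[pred v | D u v]| = 1%N.
  have [//|u_neq] := eqVneq #|[pred v | D u v]| 1%N.
  have u_gt0 := out_gt0 u T_gt1.
  have : (#|T| < #|arcs D|)%N.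
    rewrite card_arcs_out -[X in (X < _)%N]sum1_card (bigD1 u) //=.
    rewrite [X in (_ < X)%N](bigD1 u) //= -addSn leq_add //; first by lia.
    by apply: leq_sum => v _; apply: out_gt0.
  by lia.
rewrite -Tn; have out_ex u : exists v, D u v.
  by have /card_gt0P[v] := out_gt0 u T_gt1; rewrite inE; exists v.
apply: (@functional_cycle (fun u => xchoose (out_ex u))) => // u v.
have uf := xchooseP (out_ex u); apply/idP/eqP => [uv|<-//].
have /card_le1_eqP out_le1 : (#|[pred v | D u v]| <= 1)%N by rewrite out1.
exact: out_le1.
Qed.

(** Each in-degree is at most 1 plus the indicator of being 2; summing over the vertices leaves at
    least 2 for the indicators. *)
Lemma two_branchings : (#|T| + 2 <= #|arcs D|)%N ->
    (forall u, (#|[pred w | D w u]| <= 2)%N) ->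
  exists r s, [/\ r != s, #|[pred w | D w r]| = 2%N & #|[pred w | D w s]| = 2%N].
Proof.
move=> arcs_ge in_le2.
have : (1 < #|[pred u | #|[pred w | D w u]| == 2%N]|)%N.
  rewrite -(ltn_add2l #|T|); apply: (@leq_trans #|arcs D|); first by lia.
  rewrite card_arcs_in -[X in (_ <= X + _)%N]sum1_card -[X in (_ <= _ + X)%N]sum1_card.
  rewrite [X in (_ <= _ + X)%N]big_mkcond -big_split /=.
  by apply: leq_sum => u _; have := in_le2 u; rewrite inE; case: eqP; lia.
by move=> /card_gt1P[r [s [/eqP r2 /eqP s2 rs]]]; exists r, s.
Qed.
End ArcCount.

(** * Test vectors that push the spectral radius above [lam] *)

Section LowerBounds.
Variables (R : realType) (T : finType) (D : rel T) (lam : R).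
Hypothesis D_sc : strongly_connected D.
Hypothesis T_ge4 : (4 <= #|T|)%N.
Hypothesis lam_gt1 : 1 < lam.
Hypothesis lam2_lt2 : lam ^+ 2 < 2.
Hypothesis lamE : lam ^+ #|T| = lam ^+ 2 + 1.

Let lam_gt0 : 0 < lam. Proof. exact: lt_trans lam_gt1. Qed.

Lemma ler_sum_two (P : pred T) (f : T -> R) a b : (forall u, 0 <= f u) ->
  P a -> P b -> a != b -> f a + f b <= \sum_(u | P u) f u.
Proof.
move=> f_ge0 Pa Pb ab; rewrite (bigD1 a) //= (bigD1 b) /=; last by rewrite Pb eq_sym.
by rewrite addrA lerDl; apply: sumr_ge0.
Qed.

Lemma ler_sum_one (P : pred T) (f : T -> R) a : (forall u, 0 <= f u) ->
  P a -> f a <= \sum_(u | P u) f u.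
Proof. by move=> f_ge0 Pa; rewrite (bigD1 a) //= lerDl; apply: sumr_ge0. Qed.

Let pot r u := lam ^+ (#|T|.-1 - dist D r u).

Let pot_gt0 r u : 0 < pot r u. Proof. exact: exprn_gt0. Qed.
Let pot_ge0 r u : 0 <= pot r u. Proof. exact: ltW. Qed.
Let pot_ge1 r u : 1 <= pot r u. Proof. by rewrite exprn_ege1 // ltW. Qed.

Let pot_pred r w u : dist D r u = (dist D r w).+1 -> lam * pot r u = pot r w.
Proof.
move=> du; rewrite /pot -exprS; congr (_ ^+ _).
by have := dist_lt D_sc r u; lia.
Qed.

Lemma lt_spectral_radius_dist r :
    lam ^+ #|T| <= \sum_(w | D w r) pot r w ->
    lam ^+ #|T| < \sum_(w | D w r) pot r w \/
      (exists2 s, s != r & (1 < #|[pred w | D w s]|)%N) ->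
  lam < spectral_radius D R.
Proof.
move=> r_sub strict.
have potr : lam * pot r r = lam ^+ #|T|.
  by rewrite /pot distxx // subn0 -exprS prednK //; lia.
apply: (@lt_spectral_radius _ _ _ (pot r)) => //.
- exact: ltW.
- move=> u; have [->|u_neq] := eqVneq u r; first by rewrite potr.
  have [w wu /pot_pred->] := dist_pred D_sc u_neq.
  exact: ler_sum_one.
case: strict => [r_lt|[s sr /card_gt1P[a [b [as_ bs ab]]]]].
  by exists r; rewrite potr.
exists s; have [w ws /pot_pred->] := dist_pred D_sc sr.
(* The predecessor [w] alone gives equality at [s]; a further in-neighbour adds a positive
   amount. *)
have [c cs wc] : exists2 c, D c s & w != c.
  by have [wa|] := eqVneq w a; [exists b => //; rewrite wa|exists a].
apply: (@lt_le_trans _ _ (pot r w + pot r c)); first by rewrite ltrDl.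
exact: ler_sum_two.
Qed.

Lemma lt_spectral_radius_indegree r : (2 < #|[pred w | D w r]|)%N ->
  lam < spectral_radius D R.
Proof.
move=> r_gt2; have r_lt : lam ^+ #|T| < \sum_(w | D w r) pot r w.
  apply: (@lt_le_trans _ _ (2 + 1)); first by rewrite lamE ltrD2r.
  apply: (@le_trans _ _ (\sum_(w | D w r) 1)); last by apply: ler_sum.
  by rewrite sumr_const natr1 ler_nat.
by apply: (@lt_spectral_radius_dist r); [apply: ltW|left].
Qed.

Lemma lt_spectral_radius_short r s w w' : s != r ->
    (1 < #|[pred v | D v s]|)%N -> D w r -> D w' r -> w != w' ->
    (dist D r w + 3 <= #|T|)%N ->
  lam < spectral_radius D R.
Proof.
move=> sr s_gt1 wr w'r ww' w_le; apply: (@lt_spectral_radius_dist r).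
  rewrite lamE; apply: le_trans (ler_sum_two (pot_ge0 r) wr w'r ww').
  apply: lerD => //; rewrite /pot ler_eXn2l //. lia.
by right; exists s.
Qed.

Lemma lt_spectral_radius_labelling (L : T -> nat) :
    injective L -> (forall u, (L u < #|T|)%N) ->
    (forall u v, L v = (L u).+1 -> D u v) ->
    (forall u v, L u = #|T|.-1 -> (L v <= 1)%N -> D u v) ->
    (forall u v, L u = #|T|.-2 -> L v = 0%N -> D u v) ->
  lam < spectral_radius D R.
Proof.
move=> L_inj L_lt arcS arc1 arc2; have L_surj := injective_label_surj L_inj L_lt.

(* Label 1 also receives the entry 1 of label [#|T|.-1]. Lowering the entry at label 0 by 1 offsets
   this, so these two arcs supply exactly [lam ^+ #|T|.-1]. *)
pose v u := if L u == 0%N then lam ^+ #|T|.-1 - 1 else lam ^+ (#|T|.-1 - L u).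
have v_ge0 u : 0 <= v u.
  rewrite /v; case: eqP => _; last by rewrite exprn_ge0 // ltW.
  by rewrite subr_ge0 exprn_ege1 // ltW.
have v_pos u : (0 < L u)%N -> v u = lam ^+ (#|T|.-1 - L u) by rewrite /v; case: eqP => // ->.
have [x0 x0E] := L_surj 0%N ltac:(lia).
have [y yE] := L_surj #|T|.-1 ltac:(lia).
have [z zE] := L_surj #|T|.-2 ltac:(lia).
have vy : v y = 1 by rewrite v_pos yE ?subnn //; lia.
have vz : v z = lam.
  by rewrite v_pos zE; [have -> : (#|T|.-1 - #|T|.-2)%N = 1%N by lia|lia].
have vx0 : v x0 = lam ^+ #|T|.-1 - 1 by rewrite /v x0E.
have lam0 : lam * v x0 < \sum_(w | D w x0) v w.
  apply: (@lt_le_trans _ _ (v y + v z)); last first.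
    apply: ler_sum_two => //; [by apply: arc1; rewrite ?x0E|exact: arc2|].
    by apply: contraTneq T_ge4 => yz; move: yE zE; rewrite yz; lia.
  (* By [lamE] the claim becomes [lam ^+ 2 + 1 - lam < 1 + lam], that is, [lam < 2]. *)
  rewrite vx0 mulrBr -exprS prednK; last by lia.
  by rewrite lamE mulr1 vy vz; have := lam_gt1; have := lam2_lt2; lra.
apply: (@lt_spectral_radius _ _ _ v) => //; [exact: ltW| |by exists x0].
move=> u; have Lu := L_lt u; case Eu: (L u) => [|[|k]].
- by rewrite (L_inj u x0) ?ltW // x0E.
- have y_neq : x0 != y by apply: contraTneq T_ge4 => xy; move: yE x0E; rewrite -xy; lia.
  apply: le_trans (ler_sum_two v_ge0 (arcS x0 u _) (arc1 y u yE _) y_neq); rewrite ?Eu ?x0E //.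
  rewrite vx0 vy subrK v_pos ?Eu // -exprS.
  by have -> : (#|T|.-1 - 1).+1 = #|T|.-1 by lia.
- have [w wE] := L_surj k.+1 ltac:(lia).
  apply: le_trans (ler_sum_one v_ge0 (arcS w u _)); last by rewrite wE.
  rewrite !v_pos ?Eu ?wE // -exprS.
  by have -> : (#|T|.-1 - k.+2).+1 = (#|T|.-1 - k.+1)%N by lia.
Qed.

(** All [#|T|] possible distances occur on the way to [w], so each occurs once. *)
Lemma dist_inj r w : dist D r w = #|T|.-1 -> injective (dist D r).
Proof.
move=> wE; apply: surjective_label_inj => k k_lt.
by have [|u uk _] := @dist_back _ _ D_sc r w k; [lia|exists u].
Qed.

Hypothesis D_loopless : irreflexive D.

Let arc_neq u v : D u v -> u != v.
Proof. by apply: contraTneq => ->; rewrite D_loopless. Qed.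

Lemma lt_spectral_radius_hamiltonian r s w w' : s != r ->
    (1 < #|[pred v | D v s]|)%N -> D w r -> D w' r -> w != w' ->
    (#|T| <= (dist D r w').+2)%N ->
    (forall b, D b s -> (#|T| <= (dist D s b).+2)%N) ->
    dist D r w = #|T|.-1 ->
  lam < spectral_radius D R.
Proof.
move=> sr /card_gt1P[a [b [as_ bs ab]]] wr w'r ww' w'_ge s_ge wE.
have d_inj := dist_inj wE.
have d_lt := dist_lt D_sc r.
have d_neq u v : u != v -> dist D r u != dist D r v by rewrite (inj_eq d_inj).
have w'E : dist D r w' = #|T|.-2.
  by have := d_lt w'; have := d_neq _ _ ww'; rewrite wE; lia.
have s_gt0 : (0 < dist D r s)%N by rewrite lt0n dist_eq0.
(* In-neighbours of [s] are at distance at least [dist D r s - 1] and, by injectivity, not at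
   [dist D r s]; two distinct ones cannot both come just before [s]. *)
have [c cs c_gt] : exists2 c, D c s & (dist D r s < dist D r c)%N.
  have := dist_arc D_sc r as_; have := dist_arc D_sc r bs.
  have := d_neq _ _ (arc_neq as_); have := d_neq _ _ (arc_neq bs).
  have := d_neq _ _ ab => ? ? ? ? ?.
  have [a_gt|a_le] := ltnP (dist D r s) (dist D r a); first by exists a.
  by exists b => //; lia.
(* The vertex met at the distance of [s] is [s] itself, so [dist D s c <= dist D r c - dist D r s].
   With [s_ge] this leaves only distance 1 for [s] and [#|T|.-1] for [c]. *)
have [x /d_inj-> c_le] := dist_back_dist D_sc (ltnW c_gt).
have c_ge := s_ge c cs; have c_lt := d_lt c.
have sE : dist D r s = 1%N by lia.
have cw : c = w by apply: d_inj; lia.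
apply: (@lt_spectral_radius_labelling (dist D r)) => //.
- move=> u v uv; have vr : v != r by rewrite -(dist_eq0 D_sc) uv.
  have [t tv] := dist_pred D_sc vr; rewrite uv => -[/d_inj->] //.
- move=> u v; rewrite -wE => /d_inj->; rewrite leq_eqVlt ltnS leqn0 -sE.
  by case/orP => [/eqP/d_inj->|]; [rewrite -cw|rewrite dist_eq0 // => /eqP->].
- by move=> u v; rewrite -w'E => /d_inj-> /eqP; rewrite dist_eq0 // => /eqP->.
Qed.

(** The distances 0 to [#|T|.-2] all occur on the way to [y], which leaves [z] as the one extra
    vertex; it takes the label 0 freed by the shift. *)
Lemma twin_label_inj r y z : y != z -> dist D r y = #|T|.-2 ->
  dist D r z = #|T|.-2 ->
  injective (fun u => if u == z then 0%N else (dist D r u).+1).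
Proof.
move=> yz yE zE; apply: surjective_label_inj => -[|k] k_lt.
  by exists z; rewrite eqxx.
have [u uk _] : exists2 u, dist D r u = k & walk D u (dist D r y - k) y.
  by apply: dist_back => //; lia.
have [uz|uz] := eqVneq u z; last by exists u; rewrite (negPf uz) uk.
by exists y; rewrite (negPf yz) yE -uk uz zE.
Qed.

(* The Hamiltonian labelling starts at [z], not at [r]: the layers of the
   distance from [r] are shifted by one. *)
Lemma lt_spectral_radius_twins_arc r y z : D y r -> D z r -> D y z ->
    dist D r y = #|T|.-2 -> dist D r z = #|T|.-2 ->
  lam < spectral_radius D R.
Proof.
move=> yr zr yz yE zE; have L_inj := twin_label_inj (arc_neq yz) yE zE.
set L := (fun u : T => _) in L_inj.
have zr_neq : z != r by apply: arc_neq.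
have Lz : L z = 0%N by rewrite /L eqxx.
have LN u : u != z -> L u = (dist D r u).+1 by rewrite /L => /negPf->.
have Lr : L r = 1%N by rewrite LN ?distxx // eq_sym.
have Ly : L y = #|T|.-1 by rewrite LN ?arc_neq // yE; lia.
have L_neq0 u : L u != 0%N -> u != z by apply: contraNneq => ->; rewrite Lz.
have d_le u : (dist D r u <= #|T|.-2)%N.
  have := dist_lt D_sc r u; rewrite leqNgt => u_lt; apply/negP => u_gt.
  have /dist_inj d_inj : dist D r u = #|T|.-1 by lia.
  by have := arc_neq yz; rewrite (d_inj y z) ?eqxx // yE zE.
apply: (lt_spectral_radius_labelling L_inj).
- by move=> u; rewrite /L; case: eqP => _; [lia|have := d_le u; lia].
- move=> u v; have [->|uz] := eqVneq u z.
    by rewrite Lz -Lr => /L_inj->.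
  rewrite (LN u) // => vE; have /L_neq0/LN vE' : L v != 0%N by rewrite vE.
  have vr : v != r by rewrite -(dist_eq0 D_sc); lia.
  have [t tv tE] := dist_pred D_sc vr.
  have tz : t != z.
    by apply: contraTneq (d_le v) => tz; rewrite tE tz zE; lia.
  by rewrite (L_inj u t) // !LN //; lia.
- move=> u v; rewrite -Ly => /L_inj->; rewrite leq_eqVlt ltnS leqn0.
  by case/orP => /eqP; [rewrite -Lr|rewrite -Lz] => /L_inj->.
- move=> u v uE; rewrite -Lz => /L_inj->.
  (* The chord into label 0 is the last arc of a shortest walk from [r] to [z]. *)
  have [t tz tE] := dist_pred D_sc zr_neq.
  rewrite (L_inj u t) // uE LN; last exact: arc_neq.
  by rewrite -tE zE.
Qed.

(** All layers are singletons except the last, which consists of [w] and [w']. The condition on [s]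
    puts [s] in the last layer, with an arc from its twin. *)
Lemma lt_spectral_radius_twins r s w w' : s != r ->
    (1 < #|[pred v | D v s]|)%N -> D w r -> D w' r -> w != w' ->
    (forall b, D b s -> (#|T| <= (dist D s b).+2)%N) ->
    dist D r w = #|T|.-2 -> dist D r w' = #|T|.-2 ->
  lam < spectral_radius D R.
Proof.
move=> sr /card_gt1P[a [b [as_ bs ab]]] wr w'r ww' s_ge wE w'E.
have L_inj := twin_label_inj ww' wE w'E.
have d_inj u v : dist D r u = dist D r v -> dist D r u != #|T|.-2 -> u = v.
  move=> uv u_neq; apply: L_inj.
  have /negPf-> : u != w' by apply: contraNneq u_neq => ->; rewrite w'E.
  have /negPf-> : v != w' by apply: contraNneq u_neq => vw; rewrite uv vw w'E.
  by rewrite uv.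
have d_top u : dist D r u = #|T|.-2 -> u = w \/ u = w'.
  move=> uE; have [->|uw'] := eqVneq u w'; [by right|left].
  by apply: L_inj; rewrite (negPf uw') (negPf ww') uE wE.
have s_gt0 : (0 < dist D r s)%N by rewrite lt0n dist_eq0.
have d_le u : (dist D r u <= #|T|.-2)%N.
  have := dist_lt D_sc r u; rewrite leqNgt => u_lt; apply/negP => u_gt.
  have /dist_inj d_inj' : dist D r u = #|T|.-1 by lia.
  by move: ww'; rewrite (d_inj' w w') ?eqxx // wE w'E.
have s_le := d_le s.
(* Two in-neighbours nearer to [r] than [s] would share a layer before the last, hence coincide. *)
have [c cs c_ge] : exists2 c, D c s & (dist D r s <= dist D r c)%N.
  have := dist_arc D_sc r as_; have := dist_arc D_sc r bs => ? ?.
  have [a_ge|a_lt] := leqP (dist D r s) (dist D r a); first by exists a.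
  exists b => //; rewrite leqNgt; apply/negP => b_lt; move/eqP: ab; apply.
  by apply: d_inj; lia.
have c_le := d_le c.
have [sE|s_neq] := eqVneq (dist D r s) #|T|.-2; last first.
  (* Alone in its layer, [s] lies on a shortest walk from [r] to [c], so [dist D s c] is too small
     for [s_ge]. *)
  have [x xE cx] := dist_back_dist D_sc c_ge.
  have xs : x = s by apply: d_inj; rewrite xE.
  by have := s_ge c cs; move: cx; rewrite xs; lia.
have cE : dist D r c = #|T|.-2 by lia.
have top_arc u : dist D r u = #|T|.-2 -> D u r by move=> /d_top[]->.
exact: (@lt_spectral_radius_twins_arc r c s (top_arc c cE) (top_arc s sE)).
Qed.
End LowerBounds.

Theorem theorem2 (R : realType) (T : finType) (D : rel T) (n : nat)
    (D_loopless : irreflexive D)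
    (D_order : #|T| = n)
    (n_ge4 : (4 <= n)%N)
    (D_sc : strongly_connected D)
    (D_not_bicyclic : ~ strongly_connected_bicyclic D)
    (D_not_cycle : ~ isomorphic D (directed_cycle n)) :
  spectral_radius (theta 0 2 (n - 4)) R < spectral_radius D R.
Proof.
have arcs_ge := card_arcs_ge D_sc D_order n_ge4 D_not_bicyclic D_not_cycle.
have [lam [lam_gt1 lam2_lt2 lamE]] := theta_root R n_ge4.
apply: (le_lt_trans (spectral_radius_theta_le n_ge4 lam_gt1 lamE)).
rewrite -D_order in n_ge4 lamE arcs_ge.
have [/existsP[r r_gt2]|/existsPn in_le2] :=
    boolP [exists r, (2 < #|[pred w | D w r]|)%N].
  exact: (lt_spectral_radius_indegree D_sc n_ge4 lam_gt1 lam2_lt2 lamE r_gt2).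
have [|r [s [rs r2 s2]]] := @two_branchings _ D arcs_ge.
  by move=> u; rewrite leqNgt in_le2.
have short x y a : x != y -> #|[pred w | D w x]| = 2%N ->
    #|[pred w | D w y]| = 2%N -> D a x -> (dist D x a + 3 <= #|T|)%N ->
    lam < spectral_radius D R.
  move=> xy x2 y2 ax a_le.
  have /card_gt1P[b [c [bx cx bc]]] : (1 < #|[pred w | D w x]|)%N by rewrite x2.
  have [d dx ad] : exists2 d, D d x & a != d.
    by have [ab|] := eqVneq a b; [exists c => //; rewrite ab|exists b].
  have yx : y != x by rewrite eq_sym.
  have y_gt1 : (1 < #|[pred w | D w y]|)%N by rewrite y2.
  exact: (lt_spectral_radius_short D_sc n_ge4 lam_gt1 lam2_lt2 lamE
    yx y_gt1 ax dx ad a_le).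
case: (boolP [exists a in [pred a | D a r], (dist D r a + 3 <= #|T|)%N]).
  by move=> /exists_inP[a ar]; apply: short rs r2 s2 ar.
move=> /exists_inPn r_far.
case: (boolP [exists a in [pred a | D a s], (dist D s a + 3 <= #|T|)%N]).
  by move=> /exists_inP[a as_]; apply: short s2 r2 as_; rewrite eq_sym.
move=> /exists_inPn s_far.
have r_ge a : D a r -> (#|T| <= (dist D r a).+2)%N by move=> /r_far; lia.
have s_ge a : D a s -> (#|T| <= (dist D s a).+2)%N by move=> /s_far; lia.
have sr : s != r by rewrite eq_sym.
have s_gt1 : (1 < #|[pred w | D w s]|)%N by rewrite s2.
have /card_gt1P[a [b [ar br ab]]] : (1 < #|[pred w | D w r]|)%N by rewrite r2.
have a_lt := dist_lt D_sc r a; have b_lt := dist_lt D_sc r b.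
(* Both in-neighbours of [r] are now at distance [#|T|.-2] or [#|T|.-1]: either one attains the
   maximum, or they are twins in layer [#|T|.-2]. *)
have [aE|aE] := eqVneq (dist D r a) #|T|.-1.
  exact: (lt_spectral_radius_hamiltonian D_sc n_ge4 lam_gt1 lam2_lt2 lamE
    D_loopless sr s_gt1 ar br ab (r_ge b br) s_ge aE).
have [bE|bE] := eqVneq (dist D r b) #|T|.-1.
  have ba : b != a by rewrite eq_sym.
  exact: (lt_spectral_radius_hamiltonian D_sc n_ge4 lam_gt1 lam2_lt2 lamE
    D_loopless sr s_gt1 br ar ba (r_ge a ar) s_ge bE).
have a_ge := r_ge a ar; have b_ge := r_ge b br.
apply: (lt_spectral_radius_twins D_sc n_ge4 lam_gt1 lam2_lt2 lamE
  D_loopless sr s_gt1 ar br ab s_ge); lia.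
Qed.
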